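(* Let $\omega(x,y,z) = [x, y\circ z]$, where $[u,v]=uv-vu$ and $u\circ v=\tfrac12(uv+vu)$ (the Lie family, $q=\tfrac12$). The structure constants of $U(A^\omega)$ with respect to the basis $\{a^i(ba)^jb^k \mid i,j,k\ge 0\}$ are as follows: for all integers $i,j,k,\ell,m,n\ge 0$, \[ a^i(ba)^jb^k\cdot a^\ell(ba)^mb^n = \begin{cases} a^{i+\ell-1}(ba)^{j+m+1}b^{k-1+n} & \text{if } k,\ell \text{ are both odd},\\[2pt] a^{i+\ell}(ba)^{j+m}b^{k+n} & \text{if } k,\ell \text{ are both even},\\[2pt] \chi_{j,m}\, a^{2m+i+\ell+1}(ba)^{j-m-1}b^{2m+k+n+1} \\ \quad + (1-\chi_{j,m})\, a^{2j+i+\ell}(ba)^{m-j}b^{2j+k+n} & \text{if } k \text{ is even, } \ell \text{ is odd},\\[2pt] \chi_{j,m-1}\, a^{2m+i+\ell}(ba)^{j-m}b^{2m+k+n} \\ \quad + (1-\chi_{j,m-1})\, a^{2j+i+\ell+1}(ba)^{m-j-1}b^{2j+k+n+1} & \text{if } k \text{ is odd, } \ell \text{ is even}, \end{cases} \] where $\chi_{s,t} = 1$ if $s>t$ and $\chi_{s,t}=0$ otherwise.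
   Context: $\mathbb{F}$ is a field of characteristic $0$. $A$ is the 2-dimensional space of $2\times 2$ matrices over $\mathbb{F}$ with zero diagonal, with basis $e_1 = \begin{bmatrix} 0&1\\0&0\end{bmatrix}$, $e_2 = \begin{bmatrix} 0&0\\1&0\end{bmatrix}$; it is closed under triple products $xyz$ of matrices. For a trilinear operation $\omega(x,y,z)$ (a fixed rational linear combination of the six products of $x,y,z$ in all orders), $A^\omega$ denotes the space $A$ with the trilinear operation $\omega$ computed using matrix multiplication. Let $\mathbb{F}\langle a,b\rangle$ be the free unital associative algebra and $\phi\colon A \to \mathbb{F}\langle a,b\rangle$ the linear map with $\phi(e_1)=a$, $\phi(e_2)=b$. The universal associative envelope is $U(A^\omega) = \mathbb{F}\langle a,b\rangle / I$, where $I$ is the two-sided ideal generated by the elements $\omega(\phi(x),\phi(y),\phi(z)) - \phi(\omega(x,y,z))$ for $x,y,z\in\{e_1,e_2\}$. The cosets of $a,b$ in $U(A^\omega)$ are again written $a,b$. A term whose coefficient is $0$ is read as $0$, even if a formal exponent in it is negative. It is a known fact (Benkart and Roby) that the elements $a^i(ba)^jb^k$, $i,j,k\ge0$, form a basis of any down-up algebra; here $U(A^\omega)$ is the down-up algebra $A(0,1,0)$, i.e. the unital associative algebra generated by $a,b$ with relations $b^2a=ab^2$, $ba^2=a^2b$. *)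

(* Defs.v *)
From HB Require Import structures.
From mathcomp Require Import all_boot all_order all_algebra.
From mathcomp Require Import generic_quotient ring_quotient boolp.
From mathcomp.multinomials Require Import monalg.

Set Implicit Arguments.
Unset Strict Implicit.
Unset Printing Implicit Defensive.

Import GRing.Theory.
Local Open Scope ring_scope.
Local Open Scope quotient_scope.

Section Omega.
Variables (F : fieldType) (R : algType F).

Definition commutator (u v : R) : R := u * v - v * u.
Definition jordan (u v : R) : R := 2%:R^-1 *: (u * v + v * u).
Definition omega (x y z : R) : R := commutator x (jordan y z).

End Omega.

(* A^omega: the 2 x 2 matrices with zero diagonal, with the operation omega. *)
Section TripleSystem.
Variable F : fieldType.

Definition zdiag_pred : {pred 'M[F]_2} := fun M => [forall i, M i i == 0].

Lemma zdiagP (M : 'M[F]_2) : reflect (forall i, M i i = 0) (M \in zdiag_pred).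
Proof. exact: 'forall_eqP. Qed.

Fact zdiag_submod_closed : submod_closed zdiag_pred.
Proof.
split; first by apply/zdiagP => i; rewrite mxE.
move=> c M N /zdiagP M0 /zdiagP N0; apply/zdiagP => i.
by rewrite !mxE M0 N0 mulr0 addr0.
Qed.
HB.instance Definition _ :=
  GRing.isSubmodClosed.Build F 'M[F]_2 zdiag_pred zdiag_submod_closed.

Record zdiag : predArgType :=
  ZDiag { zdiag_val : 'M[F]_2; zdiag_valP : zdiag_val \in zdiag_pred }.
HB.instance Definition _ := [isSub for zdiag_val].
HB.instance Definition _ := [Choice of zdiag by <:].
HB.instance Definition _ := [SubChoice_isSubLmodule of zdiag by <:].

Fact zdiag_e1_subproof : delta_mx 0 1 \in zdiag_pred.
Proof. by apply/zdiagP => i; rewrite mxE; case: i => [[|[|]]]. Qed.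
Fact zdiag_e2_subproof : delta_mx 1 0 \in zdiag_pred.
Proof. by apply/zdiagP => i; rewrite mxE; case: i => [[|[|]]]. Qed.
Definition e1 : zdiag := ZDiag zdiag_e1_subproof.
Definition e2 : zdiag := ZDiag zdiag_e2_subproof.

Lemma zdiagM3 (x y z : 'M[F]_2) :
  x \in zdiag_pred -> y \in zdiag_pred -> z \in zdiag_pred ->
  x * y * z \in zdiag_pred.
Proof.
move=> /zdiagP x0 /zdiagP y0 /zdiagP z0; apply/zdiagP => i.
rewrite !mxE big1 // => j _; rewrite !mxE.
have [<-|ij] := eqVneq i j; first by rewrite z0 mulr0.
rewrite big1 ?mul0r // => k _.
have [<-|ik] := eqVneq i k; first by rewrite x0 mul0r.
suff -> : k = j by rewrite y0 mulr0.
by apply/val_inj; move: ij ik; case: i j k => [[|[|]]] // ? [[|[|]]] // ? [[|[|]]].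
Qed.

Fact zdiag_omega_subproof (x y z : zdiag) :
  omega (val x) (val y) (val z) \in zdiag_pred.
Proof.
rewrite /omega /commutator /jordan -scalerAr -scalerAl -scalerBr.
rewrite mulrDr mulrDl !mulrA rpredZ // rpredB // rpredD //;
  by apply: zdiagM3; apply: valP.
Qed.

Definition zdiag_omega (x y z : zdiag) : zdiag :=
  ZDiag (zdiag_omega_subproof x y z).

End TripleSystem.

(* The free unital associative algebra on two generators, as the monoid
   algebra of the free monoid of words in two letters. *)
Section FreeAlgebra.
Variable F : fieldType.

Definition free_alg : Type := {malg F[{fmonom 'I_2}]}.
HB.instance Definition _ := GRing.Lalgebra.on free_alg.

Fact free_scaleAr (c : F) (x y : free_alg) : c *: (x * y) = x * (c *: y).
Proof.
have cC (w : {malg F[{fmonom 'I_2}]}) : c%:MP * w = w * c%:MP.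
  rewrite !malgM_def fgmulUg fgmulgU; apply: eq_bigr => k _.
  by rewrite mul1m mulm1 mulrC.
have aux (v w : {malg F[{fmonom 'I_2}]}) : c *: (v * w) = v * (c *: w).
  by rewrite -!mul_malgC mulrA cC -mulrA.
exact: aux.
Qed.
HB.instance Definition _ := GRing.Lalgebra_isAlgebra.Build F free_alg
  free_scaleAr.

Definition free_gen (i : 'I_2) : free_alg := << fmu i >>.

(* The (0, 1) and (1, 0) entries are the coordinates in the basis e1, e2. *)
Definition phi (x : zdiag F) : free_alg :=
  zdiag_val x 0 1 *: free_gen 0 + zdiag_val x 1 0 *: free_gen 1.

Fact phi_is_linear : linear phi.
Proof.
move=> c x y; have E : zdiag_val (c *: x + y) = c *: val x + val y.
  exact: (linearP (val : zdiag F -> 'M[F]_2)).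
rewrite /phi E !mxE !scalerDl -!scalerA scalerDr.
exact: addrACA.
Qed.
HB.instance Definition _ :=
  GRing.isLinear.Build F (zdiag F) free_alg *:%R phi phi_is_linear.

Lemma phi_e1 : phi (e1 F) = free_gen 0.
Proof. by rewrite /phi !mxE /= scale1r scale0r addr0. Qed.

Lemma phi_e2 : phi (e2 F) = free_gen 1.
Proof. by rewrite /phi !mxE /= scale1r scale0r add0r. Qed.

End FreeAlgebra.

(* MathComp only equips quotients of commutative rings by ideals with a ring
   structure. *)
Section IdealQuotient.
Variables (F : fieldType) (A : algType F) (G : A -> Prop).

Inductive ideal_gen : A -> Prop :=
| ideal_gen_mem x : G x -> ideal_gen x
| ideal_gen0 : ideal_gen 0
| ideal_genB x y : ideal_gen x -> ideal_gen y -> ideal_gen (x - y)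
| ideal_genMl u x : ideal_gen x -> ideal_gen (u * x)
| ideal_genMr x v : ideal_gen x -> ideal_gen (x * v).

Definition ideal_pred : {pred A} := fun x => `[< ideal_gen x >].

Lemma ideal_predP x : reflect (ideal_gen x) (x \in ideal_pred).
Proof. exact: asboolP. Qed.

Fact ideal_pred_zmod_closed : zmod_closed ideal_pred.
Proof.
split; first exact/ideal_predP/ideal_gen0.
by move=> x y /ideal_predP Ix /ideal_predP Iy; apply/ideal_predP/ideal_genB.
Qed.
HB.instance Definition _ :=
  GRing.isZmodClosed.Build A ideal_pred ideal_pred_zmod_closed.

Definition alg_quot : Type := {ideal_quot ideal_pred}.
HB.instance Definition _ := GRing.Zmodule.on alg_quot.
HB.instance Definition _ := EqQuotient.on alg_quot.

Definition quot_proj (x : A) : alg_quot := \pi_alg_quot x.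

Lemma quot_projK : cancel repr quot_proj.
Proof. exact: reprK. Qed.

Lemma quot_proj_eq (x y : A) : reflect (ideal_gen (x - y)) (quot_proj x == quot_proj y).
Proof. by rewrite /quot_proj -(Quotient.idealrBE ideal_pred); apply: ideal_predP. Qed.

Lemma quot_projD (x y : A) : quot_proj (x + y) = quot_proj x + quot_proj y.
Proof. exact: (raddfD (\pi_{ideal_quot ideal_pred})). Qed.

(* The operations are locked to keep failing conversion tests from unfolding
   them down to words. *)
Fact quot_key : unit. Proof. by []. Qed.
Definition quot_one : alg_quot := quot_proj 1.
Definition quot_mul : alg_quot -> alg_quot -> alg_quot :=
  locked_with quot_key (fun x y => quot_proj (repr x * repr y)).
Definition quot_scale : F -> alg_quot -> alg_quot :=
  locked_with quot_key (fun c x => quot_proj (c *: repr x)).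

Lemma ideal_gen_repr (x : A) : ideal_gen (repr (quot_proj x) - x).
Proof. by apply/quot_proj_eq; rewrite quot_projK. Qed.

Lemma ideal_genD x y : ideal_gen x -> ideal_gen y -> ideal_gen (x + y).
Proof.
move=> Ix Iy; rewrite -[y]opprK -[- y]sub0r.
by apply: ideal_genB => //; apply: ideal_genB => //; apply: ideal_gen0.
Qed.

Lemma quot_projM (x y : A) : quot_proj (x * y) = quot_mul (quot_proj x) (quot_proj y).
Proof.
rewrite /quot_mul locked_withE; apply/esym/eqP/quot_proj_eq.
set x' := repr _; set y' := repr _.
have -> : x' * y' - x * y = (x' - x) * y' + x * (y' - y).
  by rewrite mulrBl mulrBr addrA subrK.
by apply: ideal_genD; [apply: ideal_genMr | apply: ideal_genMl];
  apply: ideal_gen_repr.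
Qed.

Lemma quot_projZ c (x : A) : quot_proj (c *: x) = quot_scale c (quot_proj x).
Proof.
rewrite /quot_scale locked_withE; apply/esym/eqP/quot_proj_eq.
rewrite -scalerBr -mulr_algl.
exact/ideal_genMl/ideal_gen_repr.
Qed.

Fact quot_mulA : associative quot_mul.
Proof.
move=> x y z; rewrite -[x]quot_projK -[y]quot_projK -[z]quot_projK.
by rewrite -!quot_projM mulrA.
Qed.
Fact quot_mul1 : left_id quot_one quot_mul.
Proof. by move=> x; rewrite -[x]quot_projK -quot_projM mul1r. Qed.
Fact quot_mulr1 : right_id quot_one quot_mul.
Proof. by move=> x; rewrite -[x]quot_projK -quot_projM mulr1. Qed.
Fact quot_mulDl : left_distributive quot_mul +%R.
Proof.
move=> x y z; rewrite -[x]quot_projK -[y]quot_projK -[z]quot_projK.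
by rewrite -quot_projD -!quot_projM mulrDl quot_projD.
Qed.
Fact quot_mulDr : right_distributive quot_mul +%R.
Proof.
move=> x y z; rewrite -[x]quot_projK -[y]quot_projK -[z]quot_projK.
by rewrite -quot_projD -!quot_projM mulrDr quot_projD.
Qed.
HB.instance Definition _ := GRing.Zmodule_isPzRing.Build alg_quot
  quot_mulA quot_mul1 quot_mulr1 quot_mulDl quot_mulDr.

Fact quot_scaleA c d x : quot_scale c (quot_scale d x) = quot_scale (c * d) x.
Proof. by rewrite -[x]quot_projK -!quot_projZ scalerA. Qed.
Fact quot_scale1 : left_id 1 quot_scale.
Proof. by move=> x; rewrite -[x]quot_projK -quot_projZ scale1r. Qed.
Fact quot_scaleDr : right_distributive quot_scale +%R.
Proof.
move=> c x y; rewrite -[x]quot_projK -[y]quot_projK.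
by rewrite -quot_projD -!quot_projZ scalerDr quot_projD.
Qed.
Fact quot_scaleDl x : {morph quot_scale^~ x : c d / c + d}.
Proof.
by move=> c d; rewrite -[x]quot_projK -!quot_projZ scalerDl quot_projD.
Qed.
HB.instance Definition _ := GRing.Zmodule_isLmodule.Build F alg_quot
  quot_scaleA quot_scale1 quot_scaleDr quot_scaleDl.

Fact quot_proj_zmod_morphism : zmod_morphism quot_proj.
Proof. exact: (raddfB (\pi_{ideal_quot ideal_pred})). Qed.
HB.instance Definition _ :=
  GRing.isZmodMorphism.Build A alg_quot quot_proj quot_proj_zmod_morphism.
Fact quot_proj_monoid_morphism : monoid_morphism quot_proj.
Proof. by split=> // x y; apply: quot_projM. Qed.
HB.instance Definition _ :=
  GRing.isMonoidMorphism.Build A alg_quot quot_proj quot_proj_monoid_morphism.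
HB.instance Definition _ :=
  GRing.isScalable.Build F A alg_quot *:%R quot_proj quot_projZ.

Fact quot_scaleAl c (x y : alg_quot) : c *: (x * y) = c *: x * y.
Proof.
rewrite -[x]quot_projK -[y]quot_projK; change (quot_scale c (quot_mul
  (quot_proj (repr x)) (quot_proj (repr y))) = quot_mul (quot_scale c (quot_proj (repr x)))
  (quot_proj (repr y))).
by rewrite -quot_projZ -!quot_projM -quot_projZ scalerAl.
Qed.
Fact quot_scaleAr c (x y : alg_quot) : c *: (x * y) = x * (c *: y).
Proof.
rewrite -[x]quot_projK -[y]quot_projK; change (quot_scale c (quot_mul
  (quot_proj (repr x)) (quot_proj (repr y))) = quot_mul (quot_proj (repr x))
  (quot_scale c (quot_proj (repr y)))).
by rewrite -quot_projZ -!quot_projM -quot_projZ scalerAr.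
Qed.

Fact quot_one_neq0 : ~ ideal_gen 1 -> (1 : alg_quot) != 0.
Proof.
move=> I1; apply/eqP; rewrite -(raddf0 quot_proj) => /eqP /quot_proj_eq.
by rewrite subr0.
Qed.

End IdealQuotient.

Section Envelope.
Variable F : fieldType.

Definition relator (x y z : zdiag F) : free_alg F :=
  omega (phi x) (phi y) (phi z) - phi (zdiag_omega x y z).

Definition relators (r : free_alg F) : Prop :=
  exists x y z, [/\ x \in [:: e1 F; e2 F], y \in [:: e1 F; e2 F],
    z \in [:: e1 F; e2 F] & r = relator x y z].

Definition envelope : Type := alg_quot relators.

HB.instance Definition _ := GRing.PzRing.on envelope.
HB.instance Definition _ := GRing.Lmodule.on envelope.
HB.instance Definition _ := EqQuotient.on envelope.

Fact ideal_relators_proper : ~ ideal_gen relators 1.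
Proof.
pose M := {malg F[{fmonom 'I_2}]}.
pose W : monomType := {fmonom 'I_2}.
pose eps : M -> F := @mcoeff W F mone.
have epsB' (x y : M) : eps (x - y) = eps x - eps y
  by exact: (raddfB (@mcoeff W F mone)).
have epsD' (x y : M) : eps (x + y) = eps x + eps y
  by exact: (raddfD (@mcoeff W F mone)).
have epsM' (x y : M) : eps (x * y) = eps x * eps y
  by exact: (rmorphM (@mcoeff W F mone)).
have epsZ' c (x : M) : eps (c *: x) = c * eps x by exact: mcoeffZ.
have eps1' : eps (1 : M) = 1
  by exact: (rmorph1 (@mcoeff W F mone)).
have gen' i : eps (free_gen F i) = 0.
  rewrite /eps /free_gen mcoeffU; case: eqP => // /(congr1 (@fdeg _)).
  by rewrite fdegU fdeg1.
have [e [eB eD eM eZ [e1 gen]]] : exists e : free_alg F -> F,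
  [/\ forall x y, e (x - y) = e x - e y, forall x y, e (x + y) = e x + e y,
      forall x y, e (x * y) = e x * e y, forall c x, e (c *: x) = c * e x
    & e 1 = 1 /\ forall i, e (free_gen F i) = 0].
  by exists eps; split; [exact: epsB' | exact: epsD' | exact: epsM'
    | exact: epsZ' | split; [exact: eps1' | exact: gen']].
have e_phi x : e (phi x) = 0.
  have gZ c i : e (c *: free_gen F i) = 0 by rewrite eZ gen mulr0.
  exact: etrans (eD _ _) (etrans (congr2 +%R (gZ _ _) (gZ _ _)) (addr0 0)).
have e0 r : ideal_gen relators r -> e r = 0.
  elim=> {r} [r [x [y [z [_ _ _ ->]]]] | | x y _ x0 _ y0 | u x _ x0 | x v _ x0].
  - apply: etrans (eB _ _) _; rewrite e_phi subr0 /omega.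
    have ew w : e (phi x * w) = 0 by rewrite eM e_phi mul0r.
    have we w : e (w * phi x) = 0 by rewrite eM e_phi mulr0.
    exact: etrans (eB _ _) (etrans (congr2 (fun a b => a - b) (ew _) (we _))
      (subrr 0)).
  - by rewrite -(subrr (0 : free_alg F)) eB subrr.
  - by rewrite eB x0 y0 subr0.
  - by rewrite eM x0 mulr0.
  - by rewrite eM x0 mul0r.
by move=> /e0 /eqP; rewrite e1 oner_eq0.
Qed.
HB.instance Definition _ := GRing.PzSemiRing_isNonZero.Build envelope
  (quot_one_neq0 ideal_relators_proper).
HB.instance Definition _ := GRing.Lmodule_isLalgebra.Build F envelope
  (@quot_scaleAl F (free_alg F) relators).
HB.instance Definition _ := GRing.Lalgebra_isAlgebra.Build F envelope
  (@quot_scaleAr F (free_alg F) relators).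

Definition env_a : envelope := quot_proj relators (free_gen F 0).
Definition env_b : envelope := quot_proj relators (free_gen F 1).

Definition env_mon (i j k : nat) : envelope :=
  env_a ^+ i * (env_b * env_a) ^+ j * env_b ^+ k.

End Envelope.

(* Hamel basis: linear independence of every finite subfamily, and spanning
   by finite linear combinations. *)
Definition is_basis (F : fieldType) (V : lmodType F) (I : eqType) (u : I -> V) :=
  (forall (s : seq I) (c : I -> F), uniq s ->
     \sum_(i <- s) c i *: u i = 0 -> {in s, forall i, c i = 0}) /\
  (forall v : V, exists (s : seq I) (c : I -> F),
     v = \sum_(i <- s) c i *: u i).

(* Integer arguments, since t may be -1. A natural-number exponent obtained by
   subtraction is truncated exactly when its term has coefficient 0. *)
Definition chi (F : fieldType) (s t : int) : F := (t < s)%R%:R.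

(* Main.v *)
From HB Require Import structures.
Require Import Defs.
From mathcomp Require Import all_boot all_order all_algebra.
From mathcomp Require Import finmap.
From mathcomp.multinomials Require Import monalg.
From mathcomp Require Import zify ring.
Import GRing.Theory.
Local Open Scope ring_scope.

(* On zero-diagonal 2 x 2 matrices [y * z + z * y] is scalar, so omega vanishes
   on A and the relators are [omega (phi x) (phi y) (phi z)].  Hence a^2 and b^2
   are central in the envelope, and moving them out of a product of two
   monomials leaves (ba)^j x (ba)^m with x one of 1, a, b, ba, where
   ba x ba = a^2 x b^2 for x = a, b.
   The relations identify words, so the envelope is a monoid algebra: a word is
   determined by how many times each letter occurs at even and at odd positions.
   Sending a word to these four numbers kills the relators and is injective on
   the monomials, which gives linear independence; the product formula shows
   that every word is a monomial, which gives spanning. *)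

(** * Products of monomials under the down-up relations *)

Definition down_up_mon {R : pzRingType} (a b : R) (i j k : nat) : R :=
  a ^+ i * (b * a) ^+ j * b ^+ k.

Section DownUpRing.
Context {R : pzRingType} {a b : R}.
Hypotheses (a2C : b * a ^+ 2 = a ^+ 2 * b) (b2C : b ^+ 2 * a = a * b ^+ 2).

Local Notation c := (b * a).
Local Notation mon := (down_up_mon a b).

(** Squares commute with both letters. Whole monomials are treated so that setting exponents to 0
    covers each of the factors moved below. *)
Lemma comm_even_down_up_mon p i j k :
  GRing.comm (a ^+ (2 * p)) (mon i j k) /\ GRing.comm (b ^+ (2 * p)) (mon i j k).
Proof.
have aa : GRing.comm (a ^+ (2 * p)) a by apply/commr_sym/commrX.
have ab : GRing.comm (a ^+ (2 * p)) b by rewrite exprM; apply/commr_sym/commrX.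
have bb : GRing.comm (b ^+ (2 * p)) b by apply/commr_sym/commrX.
have ba : GRing.comm (b ^+ (2 * p)) a by rewrite exprM; apply/commr_sym/commrX.
by split; apply: commrM; try apply: commrM; apply: commrX => //; apply: commrM.
Qed.

(** If y = z, the anticommutator is twice a central square. Otherwise it is ab + ba, whose commuting
    with a amounts to a^2 b = b a^2, and with b to b^2 a = a b^2. *)
Lemma down_up_gen_comm x y z : x \in [:: a; b] -> y \in [:: a; b] -> z \in [:: a; b] ->
  x * (y * z + z * y) = (y * z + z * y) * x.
Proof.
have [a2 b2] := (esym a2C, b2C); rewrite !expr2 !mulrA in a2 b2.
rewrite !inE => /orP[]/eqP-> /orP[]/eqP-> /orP[]/eqP->.
all: by rewrite !mulrDl !mulrDr !mulrA ?a2 ?b2 // addrC.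
Qed.

Lemma down_up_mon_shift p i j k q : a ^+ p * mon i j k * b ^+ q = mon (p + i) j (k + q).
Proof. by rewrite /down_up_mon !mulrA -exprD -!mulrA -exprD. Qed.

Lemma ba_a : c * a = a ^+ 2 * b.
Proof. by rewrite -mulrA -expr2. Qed.

Lemma b_ba : b * c = a * b ^+ 2.
Proof. by rewrite mulrA -expr2. Qed.

Lemma ba_a_ba : c * a * c = a ^+ 2 * a * b ^+ 2.
Proof. by rewrite ba_a -mulrA b_ba mulrA. Qed.

Lemma ba_b_ba : c * b * c = a ^+ 2 * b * b ^+ 2.
Proof. by rewrite -mulrA b_ba mulrA ba_a. Qed.

(* [a ^+ 2] and [b ^+ 2] are central, so each pair of outer factors [b * a] is
   traded for [a ^+ 2 * b ^+ 2]. *)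
Lemma conj_ba x m : c * x * c = a ^+ 2 * x * b ^+ 2 ->
  c ^+ m * x * c ^+ m = a ^+ (2 * m) * x * b ^+ (2 * m).
Proof.
move=> cx; elim: m => [|m IH]; first by rewrite !mulr1 !mul1r.
have [aC bC] := comm_even_down_up_mon m 0 1 0.
rewrite /down_up_mon mul1r mulr1 expr1 in aC bC.
(* Making [b * a] an atom keeps [mulrA] from splitting it. *)
move: (c) cx IH aC bC => d cx IH aC bC.
transitivity (d * (d ^+ m * x * d ^+ m) * d).
  by rewrite {1}exprS exprSr !mulrA.
rewrite IH !mulrA -aC -(mulrA _ (b ^+ _)) bC
  -!mulrA (mulrA d) (mulrA (d * x)) cx mulnS.
have -> : a ^+ (2 + 2 * m) = a ^+ (2 * m) * a ^+ 2 by rewrite addnC exprD.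
by rewrite [b ^+ (2 + _)]exprD -!mulrA.
Qed.

(** When the middle letter is a or b, [conj_ba] is applied with exponent min(j, m). The surplus
    power of ba can stay to the right of a or to the left of b; on the wrong side, one factor is
    spent by (ba)a = a^2 b or b(ba) = a b^2, whence the two shapes in each mixed case. *)
Lemma down_up_monM i j k l m n :
  mon i j k * mon l m n =
  match odd k, odd l with
  | true, true => mon (i + l - 1)%N (j + m + 1)%N (k - 1 + n)%N
  | false, false => mon (i + l)%N (j + m)%N (k + n)%N
  | false, true =>
      if (m < j)%N then mon (2 * m + i + l + 1)%N (j - m - 1)%N (2 * m + k + n + 1)%N
      else mon (2 * j + i + l)%N (m - j)%N (2 * j + k + n)%N
  | true, false =>
      if (m <= j)%N then mon (2 * m + i + l)%N (j - m)%N (2 * m + k + n)%N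
      else mon (2 * j + i + l + 1)%N (m - j - 1)%N (2 * j + k + n + 1)%N
  end.
Proof.
have -> : mon i j k * mon l m n = a ^+ (i + 2 * l./2) *
    (c ^+ j * (b ^+ odd k * a ^+ odd l) * c ^+ m) * b ^+ (2 * k./2 + n).
  have [aC _] := comm_even_down_up_mon l./2 0 j k.
  have [_ bC] := comm_even_down_up_mon k./2 (odd l) m 0.
  rewrite /down_up_mon !mul1r !mulr1 in aC bC.
  rewrite /down_up_mon -{1}(odd_double_half l) -mul2n (addnC (odd l)) exprD.
  rewrite -!mulrA (mulrA (c ^+ j)) (mulrA (c ^+ j * _)) -aC.
  rewrite -{1}(odd_double_half k) -mul2n (exprD b (odd k)).
  move: aC bC; rewrite (exprD a i) (exprD b (2 * _)).
  move: (a ^+ (2 * _)) (b ^+ (2 * _)) => A B aC bC.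
  by rewrite -!mulrA (mulrA (a ^+ odd l)) (mulrA B) bC -!mulrA.
have midE x p q r : x = mon p q r -> a ^+ (i + 2 * l./2) * x * b ^+ (2 * k./2 + n)
    = mon (i + 2 * l./2 + p) q (r + (2 * k./2 + n)).
  by move=> ->; rewrite down_up_mon_shift.
move: (odd_double_half k) (odd_double_half l).
have aC p d : a ^+ (2 * p) * c ^+ d = c ^+ d * a ^+ (2 * p).
  by have [+ _] := comm_even_down_up_mon p 0 d 0; rewrite /down_up_mon mul1r mulr1.
have bC p d : b ^+ (2 * p) * c ^+ d = c ^+ d * b ^+ (2 * p).
  by have [_ +] := comm_even_down_up_mon p 0 d 0; rewrite /down_up_mon mul1r mulr1.
have [a2 b2] := (aC 1, bC 1).
case: (odd k); case: (odd l) => /= Hk Hl; rewrite ?expr1 ?mul1r ?mulr1.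
- rewrite (midE _ 0 (j + 1 + m) 0)%N; first by congr down_up_mon; lia.
  by rewrite /down_up_mon mul1r mulr1 !exprD expr1.
- case: leqP => jm.
    rewrite (midE _ (2 * m) (j - m) (2 * m + 1))%N; first by congr down_up_mon; lia.
    rewrite -{1}(subnK jm) exprD -!mulrA (mulrA _ b) conj_ba ?ba_b_ba //.
    by rewrite !mulrA -aC /down_up_mon addn1 exprS -!mulrA.
  rewrite (midE _ (2 * j + 1) (m - j - 1) (2 + 2 * j))%N; first by congr down_up_mon; lia.
  have -> : c ^+ m = c ^+ j * (c * c ^+ (m - j - 1)).
    by rewrite -exprS -exprD; congr (_ ^+ _); lia.
  rewrite mulrA conj_ba ?ba_b_ba // -(mulrA _ (b ^+ _)) -exprS bC exprS.
  rewrite -!mulrA (mulrA b b) -(expr2 b) (mulrA _ a) b2C -(mulrA a) (mulrA (b ^+ 2)) b2.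
  by rewrite /down_up_mon exprD expr1 exprD -!mulrA.
- case: ltnP => jm.
    rewrite (midE _ (2 * m + 2) (j - m - 1) (2 * m + 1))%N; first by congr down_up_mon; lia.
    have -> : c ^+ j = c ^+ (j - m - 1) * c * c ^+ m.
      by rewrite -exprSr -exprD; congr (_ ^+ _); lia.
    rewrite -(mulrA _ (c ^+ m) a) -(mulrA _ (c ^+ m * a)) conj_ba ?ba_a_ba //.
    rewrite -exprSr 2!mulrA -aC exprSr -(mulrA (a ^+ _)) -(mulrA (c ^+ _)) ba_a.
    by rewrite (mulrA (c ^+ _)) -a2 /down_up_mon (exprD a (2 * m)) addn1 (exprS b) !mulrA.
  rewrite (midE _ (2 * j + 1) (m - j) (2 * j))%N; first by congr down_up_mon; lia.
  rewrite -{1}(subnKC jm) exprD mulrA conj_ba ?ba_a_ba //.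
  by rewrite -mulrA bC /down_up_mon exprD expr1 !mulrA.
- rewrite (midE _ 0 (j + m) 0)%N; first by congr down_up_mon; lia.
  by rewrite /down_up_mon mul1r mulr1 !exprD.
Qed.
End DownUpRing.

(** * Omega under morphisms and on A *)

Lemma omegaE (F : fieldType) (R : algType F) (x y z : R) :
  omega x y z = 2%:R^-1 *: (x * (y * z + z * y) - (y * z + z * y) * x).
Proof. by rewrite /omega /commutator /jordan -scalerAr -scalerAl -scalerBr. Qed.

Lemma omega_morph_eq0 {F : fieldType} {R : algType F} {S : lalgType F}
    (f : {lrmorphism R -> S}) (x y z : R) :
  f x * (f y * f z + f z * f y) = (f y * f z + f z * f y) * f x ->
  f (omega x y z) = 0.
Proof.
move=> fC; rewrite omegaE linearZ /= rmorphB !rmorphM rmorphD !rmorphM fC.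
by rewrite subrr scaler0.
Qed.

Lemma ideal_gen_morph_eq0 {F : fieldType} {R : algType F} {S : pzRingType}
    {G : R -> Prop} (f : {rmorphism R -> S}) x :
  (forall r, G r -> f r = 0) -> ideal_gen G x -> f x = 0.
Proof.
move=> G0; elim=> {x} [r /G0 // | | x y _ x0 _ y0 | u x _ x0 | x v _ x0].
- exact: rmorph0.
- by rewrite rmorphB x0 y0 subrr.
- by rewrite rmorphM x0 mulr0.
- by rewrite rmorphM x0 mul0r.
Qed.

Lemma rmorph_down_up_mon {R S : pzRingType} (f : {rmorphism R -> S}) (a b : R) i j k :
  f (down_up_mon a b i j k) = down_up_mon (f a) (f b) i j k.
Proof. by rewrite /down_up_mon !rmorphM !rmorphXn rmorphM. Qed.

Lemma zdiag_omega_eq0 (F : fieldType) (x y z : zdiag F) : zdiag_omega x y z = 0.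
Proof.
apply/val_inj; rewrite (raddf0 (val : zdiag F -> 'M[F]_2)) /= omegaE.
case: x y z => [x _] [y /zdiagP y0] [z /zdiagP z0] /=.
(* The product yz is diagonal with entries y01 z10 and y10 z01; symmetrizing makes the two entries
   equal. *)
suff -> : y * z + z * y = (y 0 1 * z 1 0 + z 0 1 * y 1 0)%:M.
  by rewrite -!mulmxE scalar_mxC subrr scaler0.
have ord01 (i : 'I_2) : i = 0 \/ i = 1.
  by case: i => [[|[|]]] // ?; [left | right]; apply: val_inj.
apply/matrixP => i j; rewrite !mxE !big_ord_recl !big_ord0.
rewrite (_ : ord0 = 0) // (_ : lift 0 _ = 1); last exact: val_inj.
by have [->|->] := ord01 i; have [->|->] := ord01 j; rewrite !(y0, z0) /=; ring.
Qed.

(** * Monoid algebras and the monoid of letter counts *)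

Lemma mkmalgUM {R : nzRingType} {K : monomType} (u v : K) :
  << u >> * << v >> = << mmul u v >> :> {malg R[K]}.
Proof. by rewrite malgM_def fgmulUU mul1r. Qed.

Lemma mkmalgU_exp {R : nzRingType} {K : monomType} (u : nat -> K) (w : K) n :
  u 0 = mone -> (forall m, u m.+1 = mmul w (u m)) ->
  << w >> ^+ n = << u n >> :> {malg R[K]}.
Proof.
move=> u0 uS; elim: n => [|n IH]; first by rewrite u0.
by rewrite exprS IH uS mkmalgUM.
Qed.

Lemma mkmalgUZ {R : nzRingType} {K : choiceType} (d : R) (k : K) :
  << d *g k >> = d *: << k >> :> {malg R[K]}.
Proof. by apply/malgP => k'; rewrite mcoeffZ !mcoeffU mulrnAr mulr1. Qed.

(* [((p, q), (r, s))] stands for a word with p letters a at even positions, q at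
   odd positions, and r, s likewise for b, positions being counted from 0.
   Prepending a word of odd length exchanges even and odd positions. *)
Definition walk : Type := (nat * nat) * (nat * nat).
HB.instance Definition _ := Choice.on walk.
Bind Scope monom_scope with walk.

Section Walk.
Implicit Types u v w : walk.

Definition walk_parity u := odd (u.1.1 + u.1.2 + u.2.1 + u.2.2).
Definition walk_swap (p : bool) (m : nat * nat) := if p then (m.2, m.1) else m.
Definition pair_add (m n : nat * nat) : nat * nat := (m.1 + n.1, m.2 + n.2)%N.
Definition walk_mul u v : walk :=
  let p := walk_parity u in
  (pair_add u.1 (walk_swap p v.1), pair_add u.2 (walk_swap p v.2)).
Definition walk1 : walk := ((0, 0), (0, 0))%N.

Lemma walk_parityM u v : walk_parity (walk_mul u v) = walk_parity u (+) walk_parity v.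
Proof.
rewrite /walk_mul; move: {1 2}(walk_parity u) => p.
case: u v p => [[u1 u2] [u3 u4]] [[v1 v2] [v3 v4]] [];
  by rewrite /walk_parity /= !oddD; do 8!case: (odd _).
Qed.

(** The parity of the left factor acts on the right one by the additive swap, so associativity comes
    from the additivity of parity. *)
Fact walk_mulA : associative walk_mul.
Proof.
move=> u v w; rewrite {1 2}/walk_mul [RHS]/walk_mul walk_parityM.
case: u v w => [[u1 u2] [u3 u4]] [[v1 v2] [v3 v4]] [[w1 w2] [w3 w4]].
by rewrite /walk_mul; do 2!case: walk_parity; rewrite /pair_add /= !addnA.
Qed.

Fact walk_mul1 : left_id walk1 walk_mul.
Proof. by case=> [[u1 u2] [u3 u4]]. Qed.

Fact walk_mulr1 : right_id walk1 walk_mul.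
Proof.
case=> [[u1 u2] [u3 u4]]; rewrite /walk_mul /pair_add /=.
by case: walk_parity; rewrite /= !addn0.
Qed.

Fact walk_mul_eq1 u v : walk_mul u v = walk1 -> u = walk1 /\ v = walk1.
Proof.
case: u v => [[u1 u2] [u3 u4]] [[v1 v2] [v3 v4]]; rewrite /walk_mul /pair_add /=.
by case: walk_parity => -[] /= *; split; congr ((_, _), (_, _)); lia.
Qed.

HB.instance Definition _ := Choice_isMonomialDef.Build walk
  walk_mulA walk_mul1 walk_mulr1 walk_mul_eq1.

Lemma mmul_walkE u v : mmul u v =
  (pair_add u.1 (walk_swap (walk_parity u) v.1),
   pair_add u.2 (walk_swap (walk_parity u) v.2)).
Proof. by []. Qed.

End Walk.

Definition walk_gen (i : 'I_2) : walk :=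
  if i == 0 then ((1, 0), (0, 0))%N else ((0, 0), (1, 0))%N.

Section WalkRep.
Context {F : fieldType}.

Definition walk_of (w : {fmonom 'I_2}) : {malg F[walk]} :=
  << foldr (fun i => mmul (walk_gen i)) mone (w : seq 'I_2) >>.

Fact walk_of_mmorphism : mmorphism walk_of.
Proof.
split=> [u v|]; rewrite /walk_of ?fm1 // fmM mkmalgUM.
congr (<< _ >>).
by elim: (u : seq _) => [|i s IH] /=; rewrite ?mul1m // IH mulmA.
Qed.
HB.instance Definition _ :=
  isMultiplicative.Build {fmonom 'I_2} {malg F[walk]} walk_of walk_of_mmorphism.

Definition walk_rep (x : free_alg F) : {malg F[walk]} :=
  mmap (@mkmalgU walk F mone) walk_of x.

Fact walk_rep_zmod_morphism : zmod_morphism walk_rep.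
Proof. exact: mmapB. Qed.
HB.instance Definition _ := GRing.isZmodMorphism.Build (free_alg F) {malg F[walk]}
  walk_rep walk_rep_zmod_morphism.

Fact walk_rep_monoid_morphism : monoid_morphism walk_rep.
Proof.
(* [mmap] is multiplicative once scalars commute with the images of words; constants sit at the
   unit, so commutativity of F is enough. *)
have comm (x : {malg F[{fmonom 'I_2}]}) u v : GRing.comm (x@_u)%:MP (walk_of v).
  by rewrite /GRing.comm !malgM_def !fgmulUU mul1m mulm1 mulrC.
have [repM _] := commr_mmap_is_multiplicative comm.
split; [exact: mmap1 | exact: repM].
Qed.
HB.instance Definition _ := GRing.isMonoidMorphism.Build (free_alg F) {malg F[walk]}
  walk_rep walk_rep_monoid_morphism.

Fact walk_rep_scalable : scalable walk_rep.
Proof.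
move=> c x; apply: etrans (mmapZ (c : F) (x : {malg F[{fmonom 'I_2}]})) _.
exact: mul_malgC.
Qed.
HB.instance Definition _ := GRing.isScalable.Build F (free_alg F) {malg F[walk]}
  *:%R walk_rep walk_rep_scalable.

Lemma walk_rep_gen i : walk_rep (free_gen F i) = << walk_gen i >>.
Proof. by rewrite /walk_rep mmapU /= /walk_of fmU mul1r /= mulm1. Qed.

End WalkRep.

(** * Linear independence of the monomials *)

Section Envelope.
Context {F : fieldType}.
Local Notation gens := [:: e1 F; e2 F].

Lemma relatorE (x y z : zdiag F) : relator x y z = omega (phi x) (phi y) (phi z).
Proof. by rewrite /relator zdiag_omega_eq0 raddf0 subr0. Qed.

Lemma walk_rep_ideal x : ideal_gen (@relators F) x -> walk_rep x = 0.
Proof.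
apply: (ideal_gen_morph_eq0 walk_rep).
move=> _ [x' [y [z [hx hy hz ->]]]]; rewrite relatorE.
pose A : {malg F[walk]} := << walk_gen 0 >>.
pose B : {malg F[walk]} := << walk_gen 1 >>.
(* The walk of a^2 is ((1, 1), (0, 0)), of even length and fixed by the swap, hence central;
   similarly for b^2. *)
have AC : B * A ^+ 2 = A ^+ 2 * B by rewrite !expr2 !mkmalgUM; congr (<< _ >>).
have BC : B ^+ 2 * A = A * B ^+ 2 by rewrite !expr2 !mkmalgUM; congr (<< _ >>).
have repG t : t \in gens -> walk_rep (phi t) \in [:: A; B].
  by rewrite !inE => /orP[]/eqP->; rewrite ?phi_e1 ?phi_e2 walk_rep_gen eqxx ?orbT.
apply: (omega_morph_eq0 walk_rep).
exact: (down_up_gen_comm AC BC _ _ _ (repG _ hx) (repG _ hy) (repG _ hz)).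
Qed.

Definition free_mon (t : nat * nat * nat) : free_alg F :=
  down_up_mon (free_gen F 0) (free_gen F 1) t.1.1 t.1.2 t.2.

Lemma env_monE t : env_mon F t.1.1 t.1.2 t.2 = quot_proj (@relators F) (free_mon t).
Proof. exact/esym/(rmorph_down_up_mon (quot_proj (@relators F))). Qed.

(** These are the letter counts of a^i (ba)^j b^k. Each ba and the final b^k start at a position of
    the parity of i. *)
Definition walk_key (t : nat * nat * nat) : walk :=
  let: (i, j, k) := t in
  if odd i then ((uphalf i + j, i./2), (k./2, j + uphalf k))%N
  else ((uphalf i, i./2 + j), (j + uphalf k, k./2))%N.

(** The count of a at even positions minus that at odd positions is j + 1 for odd i and -j for even
    i. Its sign gives the parity of i, its value gives j, and the other counts then give i and k. *)
Lemma walk_key_inj : injective walk_key.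
Proof.
move=> [[i j] k] [[l m] n]; rewrite /walk_key.
case: (boolP (odd i)) => hi; case: (boolP (odd l)) => hl [] *; congr (_, _, _); lia.
Qed.

Lemma walk_rep_mon t : walk_rep (free_mon t) = << walk_key t >>.
Proof.
case: t => [[i j] k].
rewrite (rmorph_down_up_mon walk_rep) /= !walk_rep_gen /down_up_mon mkmalgUM.
have -> : << walk_gen 0 >> ^+ i = << ((uphalf i, i./2), (0, 0))%N >> :> {malg F[walk]}.
  exact: (mkmalgU_exp (fun n => ((uphalf n, n./2), (0, 0))%N : walk)).
have -> : << mmul (walk_gen 1) (walk_gen 0) >> ^+ j =
    << ((0, j), (j, 0))%N >> :> {malg F[walk]}.
  exact: (mkmalgU_exp (fun n => ((0, n), (n, 0))%N : walk)).
have -> : << walk_gen 1 >> ^+ k = << ((0, 0), (uphalf k, k./2))%N >> :> {malg F[walk]}.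
  exact: (mkmalgU_exp (fun n => ((0, 0), (uphalf n, n./2))%N : walk)).
rewrite !mkmalgUM; congr (<< _ >>).
(* Prefix parities decide the swaps: a^i has the parity of i, and (ba)^j has even length. *)
have p1 : walk_parity ((uphalf i, i./2), (0, 0))%N = odd i by rewrite /walk_parity /=; lia.
have p2 : walk_parity ((0, j), (j, 0))%N = false by rewrite /walk_parity /=; lia.
rewrite mmul_walkE [walk_parity _]walk_parityM p1 p2 addbF mmul_walkE p1 /walk_key.
by case: (odd i); rewrite /pair_add /= ?add0n ?addn0.
Qed.

(** Distinct monomials go to distinct basis elements of the monoid algebra, so the coefficient at
    [walk_key t] isolates [c t]. *)
Lemma free_mon_ind (s : seq (nat * nat * nat)) (c : nat * nat * nat -> F) :
  uniq s -> ideal_gen (@relators F) (\sum_(t <- s) c t *: free_mon t) ->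
  {in s, forall t, c t = 0}.
Proof.
move=> us /walk_rep_ideal; rewrite raddf_sum => E t ts.
have := congr1 (mcoeff (walk_key t)) E.
rewrite raddf_sum mcoeff0 (bigD1_seq t) //= big1 => [|t' t't].
  by rewrite linearZ /= walk_rep_mon mcoeffZ mcoeffUU mulr1 addr0.
rewrite linearZ /= walk_rep_mon mcoeffZ mcoeffU (inj_eq walk_key_inj) (negPf t't).
by rewrite mulr0.
Qed.

End Envelope.

(** * Finite spans *)

Lemma span_add (F : fieldType) (V : lmodType F) (I : eqType) (u : I -> V) i d v :
  (exists (s : seq I) (c : I -> F), uniq s /\ v = \sum_(j <- s) c j *: u j) ->
  exists (s : seq I) (c : I -> F),
    uniq s /\ d *: u i + v = \sum_(j <- s) c j *: u j.
Proof.
case=> s [c [us ->]]; have [si | si] := boolP (i \in s).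
  (* An index already listed has its coefficient increased by [d], which keeps the list free of
     repetitions. *)
  exists s, (fun j => (j == i)%:R * d + c j); split=> //.
  under [RHS]eq_bigr do rewrite scalerDl.
  rewrite big_split /= [X in _ = X + _](bigD1_seq i) //= eqxx mul1r.
  rewrite [X in _ = _ + X + _]big1 ?addr0 // => j /negPf->.
  by rewrite mul0r scale0r.
exists (i :: s), (fun j => if j == i then d else c j); rewrite /= si us; split=> //.
rewrite big_cons eqxx; congr (_ + _); apply: eq_big_seq => j js.
by case: eqP js si => // -> ->.
Qed.

Lemma span_sum (F : fieldType) (V : lmodType F) (I W : eqType) (u : I -> V)
    (g : W -> V) (r : seq W) (c : W -> F) :
  (forall w, exists i, g w = u i) ->
  exists (s : seq I) (c' : I -> F),
    uniq s /\ \sum_(w <- r) c w *: g w = \sum_(j <- s) c' j *: u j.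
Proof.
move=> gu; elim: r => [|w r IH].
  by exists [::], (fun=> 0); rewrite !big_nil.
by rewrite big_cons; have [i ->] := gu w; apply: span_add.
Qed.

(** * Relations, products and spanning in the envelope *)

Section EnvelopeRelations.
Context {F : fieldType}.
Hypothesis charF0 : [pchar F] =i pred0.
Local Notation gens := [:: e1 F; e2 F].
Local Notation pi := (quot_proj (@relators F)).

(** Characteristic 0 makes 2 invertible, so the factor 1/2 cancels the doubled y^2. The relators
    with y = z thus make a^2 and b^2 central. *)
Lemma omega_diag (R : algType F) (x y : R) : omega x y y = x * y ^+ 2 - y ^+ 2 * x.
Proof.
have n2 : 2%:R != 0 :> F by move: (charF0 2); rewrite !inE /= => ->.
rewrite omegaE -!mulr2n mulrnAr mulrnAl -mulrnBl -scaler_nat scalerA.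
by rewrite mulVf // scale1r expr2.
Qed.

Lemma env_sqr_comm (x y : zdiag F) : x \in gens -> y \in gens ->
  pi (phi x) * pi (phi y) ^+ 2 = pi (phi y) ^+ 2 * pi (phi x).
Proof.
move=> hx hy; rewrite -!rmorphXn -!rmorphM; apply/eqP/quot_proj_eq.
by rewrite -omega_diag -relatorE; apply: ideal_gen_mem; exists x, y, y.
Qed.

Lemma env_a2C : env_b F * env_a F ^+ 2 = env_a F ^+ 2 * env_b F.
Proof.
by rewrite /env_a /env_b -phi_e1 -phi_e2; apply: env_sqr_comm; rewrite !inE eqxx ?orbT.
Qed.

Lemma env_b2C : env_b F ^+ 2 * env_a F = env_a F * env_b F ^+ 2.
Proof.
apply: esym.
by rewrite /env_a /env_b -phi_e1 -phi_e2; apply: env_sqr_comm; rewrite !inE eqxx ?orbT.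
Qed.

Lemma env_monM i j k l m n :
  env_mon F i j k * env_mon F l m n =
  match odd k, odd l with
  | true, true => env_mon F (i + l - 1)%N (j + m + 1)%N (k - 1 + n)%N
  | false, false => env_mon F (i + l)%N (j + m)%N (k + n)%N
  | false, true =>
      if (m < j)%N then env_mon F (2 * m + i + l + 1)%N (j - m - 1)%N (2 * m + k + n + 1)%N
      else env_mon F (2 * j + i + l)%N (m - j)%N (2 * j + k + n)%N
  | true, false =>
      if (m <= j)%N then env_mon F (2 * m + i + l)%N (j - m)%N (2 * m + k + n)%N
      else env_mon F (2 * j + i + l + 1)%N (m - j - 1)%N (2 * j + k + n + 1)%N
  end.
Proof. exact: (down_up_monM env_a2C env_b2C). Qed.

(** Induction on the word: prepending a raises the first exponent, and prepending b multiplies by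
    the monomial b, where [env_monM] returns a single monomial. *)
Lemma quot_word (w : {fmonom 'I_2}) :
  exists t, pi (<< w >> : {malg F[{fmonom 'I_2}]}) = env_mon F t.1.1 t.1.2 t.2.
Proof.
case: w; elim=> [|i s [[[l m] n] IH]].
  exists (0, 0, 0)%N; rewrite /env_mon !mulr1 -fmoneE; exact: (rmorph1 pi).
have -> : << FMonom (i :: s) >> = free_gen F i * << FMonom s >>.
  by rewrite [RHS]mkmalgUM; congr (<< _ >>); rewrite [RHS]fmmulE fmU.
rewrite rmorphM /= IH.
have [->|->] : i = 0 \/ i = 1.
  by case: i => [[|[|]]] // ?; [left | right]; apply: val_inj.
  by exists (l.+1, m, n); rewrite /env_mon exprS !mulrA.
have -> : pi (free_gen F 1) = env_mon F 0 0 1 by rewrite /env_mon !mul1r.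
rewrite env_monM /=; case: ifP => _; last by case: ifP => _; eexists (_, _, _).
by eexists (_, _, _).
Qed.

Lemma env_span (v : envelope F) : exists (s : seq (nat * nat * nat)) c,
  uniq s /\ v = \sum_(t <- s) c t *: env_mon F t.1.1 t.1.2 t.2.
Proof.
rewrite -(quot_projK v); move: (repr v) => x.
have [s ->] : exists s : seq {fmonom 'I_2},
    x = \sum_(w <- s) (x : {malg F[_]})@_w *: (<< w >> : free_alg F).
  exists (enum_fset (msupp (x : {malg F[_]}))); rewrite {1}[x]monalgE.
  by apply: eq_bigr => w _; apply: mkmalgUZ.
rewrite linear_sum; under eq_bigr do rewrite linearZ.
pose mon (t : nat * nat * nat) := env_mon F t.1.1 t.1.2 t.2.
exact: (span_sum _ _ _ _ mon _ _ _ quot_word).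
Qed.
End EnvelopeRelations.

Theorem theorem4p25 (F : fieldType) (charF0 : [pchar F] =i pred0) :
  is_basis (fun t : nat * nat * nat => env_mon F t.1.1 t.1.2 t.2) /\
  forall i j k l m n : nat,
    env_mon F i j k * env_mon F l m n =
    match odd k, odd l with
    | true, true => env_mon F (i + l - 1)%N (j + m + 1)%N (k - 1 + n)%N
    | false, false => env_mon F (i + l)%N (j + m)%N (k + n)%N
    | false, true =>
        chi F j m *: env_mon F (2 * m + i + l + 1)%N (j - m - 1)%N
                               (2 * m + k + n + 1)%N
        + (1 - chi F j m) *: env_mon F (2 * j + i + l)%N (m - j)%N
                                       (2 * j + k + n)%N
    | true, false =>
        chi F j (m%:Z - 1) *: env_mon F (2 * m + i + l)%N (j - m)%N
                                        (2 * m + k + n)%N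
        + (1 - chi F j (m%:Z - 1)) *:
            env_mon F (2 * j + i + l + 1)%N (m - j - 1)%N
                      (2 * j + k + n + 1)%N
    end.
Proof.
split; first split.
(* A vanishing combination in the envelope is lifted to an element of the ideal, seen as a
   difference with 0. *)
- move=> s c us s0; apply: (free_mon_ind _ _ us); rewrite -[X in ideal_gen _ X]subr0.
  apply/quot_proj_eq; rewrite raddf0 -[X in _ == X]s0 linear_sum; apply/eqP.
  by apply: eq_bigr => t _; rewrite linearZ /= env_monE.
- by move=> v; have [s [c [_ ->]]] := env_span charF0 v; exists s, c.
- have chiE (V : lmodType F) (p q : int) (x y : V) :
      chi F p q *: x + (1 - chi F p q) *: y = if (q < p)%R then x else y.
    by rewrite /chi; case: (q < p)%R; rewrite ?subrr ?subr0 scale1r scale0r ?addr0 ?add0r.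
  move=> i j k l m n; rewrite (env_monM charF0) !chiE ltz_nat.
  (* The subtraction is in the integers, so m = 0 gives the bound -1 and the equivalence still
     holds. *)
  by have -> : (m%:Z - 1 < j%:Z)%R = (m <= j)%N by lia.
Qed.
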